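(* Fix $m\ge 1$ and $n$, and let $K\subseteq Set_{n,m}$ be an $m$-dimensional complex on $n$ points. Then the cone $\mathrm{HMET}(K)\subseteq\mathbb{R}^K$ is the image of the cone $\mathrm{HMET}(Set_{n,m})\subseteq\mathbb{R}^{Set_{n,m}}$ under the coordinate projection onto the coordinates indexed by the simplices in $K$.
   Context: $Set_{n,m}$ is the set of subsets of $\{1,\dots,n\}$ with exactly $m+1$ elements (called simplices). An $m$-dimensional complex on $\{1,\dots,n\}$ is a subset $K\subseteq Set_{n,m}$. A closed manifold of dimension $m$ is a subset $\mathcal{S}\subseteq Set_{n,m}$ such that for every subset $S$ of $\{1,\dots,n\}$ with exactly $m$ elements, the number of simplices of $\mathcal{S}$ containing $S$ is even. For an $m$-dimensional complex $K$, the hemimetric cone $\mathrm{HMET}(K)$ is the set of functions $d:K\to\mathbb{R}$ such that (i) $d(\Delta)\ge 0$ for all $\Delta\in K$; and (ii) for every closed manifold $\{\Delta_1,\dots,\Delta_r\}$ (distinct simplices) with all $\Delta_i\in K$, and every $1\le i\le r$, $d(\Delta_i)\le\sum_{1\le j\le r,\ j\ne i} d(\Delta_j)$. *)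

(* Defs.v *)
From HB Require Import structures.
From mathcomp Require Import all_boot all_order all_algebra.
From mathcomp Require Import classical_sets reals.

Set Implicit Arguments.
Unset Strict Implicit.
Unset Printing Implicit Defensive.

Import Order.TTheory GRing.Theory Num.Theory.
Local Open Scope ring_scope.

(* The ground set {1, ..., n} is 'I_n, and a family of simplices is a finite
   set of subsets of 'I_n. *)
Definition Simplices (n m : nat) : {set {set 'I_n}} :=
  [set D : {set 'I_n} | #|D| == m.+1]%SET.

(* The empty family is a closed manifold; it is harmless, since it yields no
   inequality in [HMET]. *)
Definition closed_manifold (n m : nat) (M : {set {set 'I_n}}) : Prop :=
  M \subset Simplices n m /\
  forall F : {set 'I_n}, #|F| = m ->
    ~~ odd #|[set D in M | F \subset D]%SET|.

(* The simplices of K as a type, so that R^K is {ffun cells K -> R}. *)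
Definition cells (n : nat) (K : {set {set 'I_n}}) : finType :=
  {D : {set 'I_n} | D \in K}.

(* A closed manifold is given as a set M, so the sum over the j <> i runs over
   the elements of M other than D. *)
Definition HMET (R : realType) (n m : nat) (K : {set {set 'I_n}}) :
    set {ffun cells K -> R} :=
  [set d : {ffun cells K -> R} |
    (forall D : cells K, 0 <= d D) /\
    (forall M : {set {set 'I_n}}, closed_manifold m M -> M \subset K ->
      forall D : cells K, val D \in M ->
        d D <= \sum_(E : cells K | (val E \in M) && (E != D)) d E)]%classic.

Arguments HMET R {n} m K.

Definition cell_incl (n : nat) (K L : {set {set 'I_n}}) (KL : K \subset L)
    (D : cells K) : cells L :=
  exist _ (val D) (fintype.subsetP KL (val D) (valP D)).

Definition coord_proj (R : realType) (n : nat) (K L : {set {set 'I_n}})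
    (KL : K \subset L) (d : {ffun cells L -> R}) : {ffun cells K -> R} :=
  [ffun D => d (cell_incl KL D)].

Arguments coord_proj R {n K L} KL d.

(* Main.v *)
(* Call a chain N \subset K a filling of a simplex D if N and {D} have the same
   boundary mod 2.  The extension of d to D is the least d-weight of a filling
   of D, the whole of K being admitted as a fallback when D has no filling.  In
   a closed manifold containing D, the symmetric difference of fillings of the
   other simplices fills D, and weights are subadditive under symmetric
   difference.  On K the extension agrees with d: if N fills D in K and does
   not contain D, then N together with D is a closed manifold in K. *)
Require Import Defs.
From HB Require Import structures.
From mathcomp Require Import all_boot all_order all_algebra.
From mathcomp Require Import classical_sets reals.

Set Implicit Arguments.
Unset Strict Implicit.
Unset Printing Implicit Defensive.

Import Order.TTheory GRing.Theory Num.Theory.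
Local Open Scope ring_scope.

Definition symdiff (T : finType) (A B : {set T}) : {set T} :=
  [set x | (x \in A) (+) (x \in B)]%SET.

(** For [F] of size m and a family [A] of simplices, this is the coefficient at [F] of the mod 2
    boundary of the chain [A]; [symdiff] is the sum of chains. *)
Definition coface_parity (n : nat) (F : {set 'I_n}) (A : {set {set 'I_n}}) :
    bool :=
  \big[addb/false]_(D in A) (F \subset D).

Lemma odd_card_cofaces (n : nat) (F : {set 'I_n}) (A : {set {set 'I_n}}) :
  odd #|[set D in A | F \subset D]%SET| = coface_parity F A.
Proof.
rewrite -sum1dep_card big_mkcondr (big_morph odd oddD (erefl _)).
by apply: eq_bigr => D _; case: ifP.
Qed.

Lemma coface_parity_symdiff (n : nat) (F : {set 'I_n}) :
  {morph coface_parity F : A B / symdiff A B >-> A (+) B}.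
Proof.
move=> A B; rewrite /coface_parity !(big_mkcond (fun D => D \in _)) -big_split.
apply: eq_bigr => D _; rewrite inE.
by case: (D \in A); case: (D \in B); case: (F \subset D).
Qed.

(** Common elements count twice on the right and not at all on the left. *)
Lemma sum_symdiff_le (R : numDomainType) (T : finType) (f : T -> R)
    (A B : {set T}) : (forall x, 0 <= f x) ->
  \sum_(x in symdiff A B) f x <= \sum_(x in A) f x + \sum_(x in B) f x.
Proof.
move=> f0; rewrite !(big_mkcond (fun D => D \in _)) -big_split.
apply: ler_sum => x _; rewrite inE.
by case: (x \in A); case: (x \in B); rewrite /= ?addr0 ?add0r ?addr_ge0.
Qed.

Section Fillings.
Variables (n m : nat).
Implicit Types (F D E : {set 'I_n}) (K L M N : {set {set 'I_n}}).

Definition fills D N : bool :=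
  [forall F : {set 'I_n}, (#|F| == m) ==> (coface_parity F N == (F \subset D))].

Lemma fillsP D N :
  reflect (forall F, #|F| = m -> coface_parity F N = (F \subset D)) (fills D N).
Proof.
apply: (iffP forallP) => [fN F /eqP cF | fN F]; first by move/implyP: (fN F) => /(_ cF)/eqP.
by apply/implyP => /eqP cF; rewrite fN.
Qed.

Lemma fills_set1 D : fills D [set D]%SET.
Proof. by apply/fillsP => F _; rewrite /coface_parity big_set1. Qed.

(** Since [D] is not in [N], the boundary of the union is the sum of two equal boundaries, which
    vanishes mod 2. *)
Lemma closed_manifold_fills D N : fills D N -> D \notin N ->
  D |: N \subset Simplices n m -> closed_manifold m (D |: N).
Proof.
move=> /fillsP fN DN sN; split=> // F cF.
by rewrite odd_card_cofaces /coface_parity big_setU1 //= [X in _ (+) X]fN ?addbb.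
Qed.

(** The boundary is additive, and in a closed [M] the boundaries of the simplices other than [D] add
    up to that of [D]. *)
Lemma fills_big_symdiff M D (N : {set 'I_n} -> {set {set 'I_n}}) :
  closed_manifold m M -> D \in M ->
  (forall E, E \in M :\ D -> fills E (N E)) ->
  fills D (\big[@symdiff _/finset.set0]_(E in M :\ D) N E).
Proof.
move=> [_ cM] DM fN; apply/fillsP => F cF.
rewrite (big_morph _ (coface_parity_symdiff F) (big_set0 _ _ _)).
rewrite (eq_bigr (fun E => F \subset E)) => [|E EM]; last exact: (fillsP _ _ (fN E EM)).
have := cM F cF; rewrite odd_card_cofaces /coface_parity (big_setD1 D DM) /=.
by case: (F \subset D); case: (\big[_/_]_(_ in _) _).
Qed.

Variable R : realType.
Implicit Types (f : {set 'I_n} -> R).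

(** Total functions on sets of vertices serve for every complex at once, which avoids transport
    between the types [cells K] and [cells L]. *)
Definition restr K f : {ffun cells K -> R} := [ffun D => f (val D)].

Definition extend0 K (d : {ffun cells K -> R}) D : R :=
  if insub D is Some D' then d D' else 0.

Lemma extend0K K : cancel (@extend0 K) (restr K).
Proof. by move=> d; apply/ffunP => D; rewrite ffunE /extend0 valK. Qed.

Lemma coord_proj_restr K L (KL : K \subset L) f :
  coord_proj R KL (restr L f) = restr K f.
Proof. by apply/ffunP => D; rewrite !ffunE. Qed.

Lemma sum_cells K M (D : cells K) f : M \subset K ->
  \sum_(E : cells K | (val E \in M) && (E != D)) restr K f E =
  \sum_(E in M :\ val D) f E.
Proof.
move=> MK; rewrite [RHS](reindex_omap val (fun E => insub E : option (cells K))) /=.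
  apply: eq_big => [E|E _]; last by rewrite ffunE.
  by rewrite !inE valK eqxx andbT andbC -val_eqE.
move=> E; rewrite !inE => /andP[_ EM].
by case: insubP => [u _ /= -> //|]; rewrite (fintype.subsetP MK).
Qed.

Definition hemimetric K f : Prop :=
  (forall D, D \in K -> 0 <= f D) /\
  (forall M, closed_manifold m M -> M \subset K ->
     forall D, D \in M -> f D <= \sum_(E in M :\ D) f E).

Lemma HMET_restr K f : HMET R m K (restr K f) <-> hemimetric K f.
Proof.
split=> [[f0 fM]|[f0 fM]]; split.
- by move=> D DK; have := f0 (exist _ D DK); rewrite ffunE.
- move=> M cM MK D DM; have := fM M cM MK (exist _ D (fintype.subsetP MK D DM)) DM.
  by rewrite sum_cells // ffunE.
- by move=> D; rewrite ffunE f0 // (valP D).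
- by move=> M cM MK D DM; rewrite sum_cells // ffunE fM.
Qed.

Lemma hemimetricS K L f : K \subset L -> hemimetric L f -> hemimetric K f.
Proof.
move=> KL [f0 fM]; split=> [D DK|M cM MK]; first exact/f0/(fintype.subsetP KL).
exact/fM/(fintype.subset_trans MK).
Qed.

Section Extension.
Variables (K : {set {set 'I_n}}) (f : {set 'I_n} -> R).
Hypotheses (f0 : forall D, 0 <= f D).

Definition weight N : R := \sum_(E in N) f E.

Definition admissible D N : bool := (N \subset K) && (fills D N || (N == K)).

(** The default [K] of the minimum is itself admissible for every [D]. *)
Definition best D : {set {set 'I_n}} := [arg min_(N < K | admissible D N) weight N]%O.

Definition extension D : R := weight (best D).

Lemma bestP D : admissible D (best D) /\
  forall N, admissible D N -> weight (best D) <= weight N.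
Proof.
rewrite /best; case: Order.TotalTheory.arg_minP => //.
by rewrite /admissible fintype.subxx eqxx orbT.
Qed.

Lemma weight_ge0 N : 0 <= weight N.
Proof. exact: sumr_ge0. Qed.

Lemma weight_le D N : D \in N -> f D <= weight N.
Proof. by move=> DN; rewrite /weight (big_setD1 D) //= lerDl sumr_ge0. Qed.

Lemma extension_leK D : extension D <= weight K.
Proof.
by apply: (bestP D).2; rewrite /admissible fintype.subxx eqxx orbT.
Qed.

Lemma weight_big_symdiff (I : finType) (A : {set I}) (N : I -> {set {set 'I_n}}) :
  weight (\big[@symdiff _/finset.set0]_(i in A) N i) <= \sum_(i in A) weight (N i).
Proof.
apply: (big_ind2 (fun X x => weight X <= x)) => //; first by rewrite /weight big_set0.
move=> X x Y y Xx Yy; apply: le_trans (sum_symdiff_le _ _ f0) _.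
exact: lerD.
Qed.

Lemma hemimetric_extension L : hemimetric L extension.
Proof.
split=> [D _|M cM _ D DM]; first exact: weight_ge0.
(* If the best chain of some other simplex [E] is the fallback [K], the term of [E] alone is the
   weight of [K], which bounds every value of [extension]. *)
have [/exists_inP[E EM nE]|] := boolP [exists E in M :\ D, ~~ fills E (best E)].
  have [/andP[_]] := bestP E; rewrite (negbTE nE) /= => /eqP bE _.
  apply: (le_trans (extension_leK D)); rewrite (big_setD1 E EM) /= /extension bE.
  by rewrite lerDl sumr_ge0 // => ? _; exact: weight_ge0.
rewrite negb_exists_in => /forall_inP fM.
(* Otherwise the symmetric difference of the chosen fillings competes in the minimum for [D]. *)
apply: le_trans (weight_big_symdiff _ _); apply: (bestP D).2.
rewrite /admissible fills_big_symdiff //; last by move=> E /fM/negPn.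
rewrite andbT; apply: (big_ind (fun X : {set {set _}} => X \subset K)); first exact: finset.sub0set.
  move=> X Y /fintype.subsetP XK /fintype.subsetP YK; apply/fintype.subsetP => E.
  by rewrite inE; case: (boolP (E \in X)) => [/XK //|_ /YK].
by move=> E _; have [/andP[]] := bestP E.
Qed.

Lemma extension_id D : K \subset Simplices n m -> hemimetric K f -> D \in K ->
  extension D = f D.
Proof.
move=> sK [_ fM] DK; apply/le_anti/andP; split.
  (* The simplex [D] fills itself. *)
  have -> : f D = weight [set D]%SET by rewrite /weight big_set1.
  by apply: (bestP D).2; rewrite /admissible finset.sub1set DK fills_set1.
have [/andP[bK bD] _] := bestP D.
have [Db|Db] := boolP (D \in best D); first exact: weight_le.
(* The fallback contains [D], so here [best D] is a genuine filling. *)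
case/orP: bD => [bD|/eqP bD]; last by rewrite bD DK in Db.
have UK : D |: best D \subset K by rewrite finset.subUset finset.sub1set DK.
have := fM _ (closed_manifold_fills bD Db (fintype.subset_trans UK sK)) UK D (finset.setU11 _ _).
by rewrite finset.setU1K.
Qed.

End Extension.
End Fillings.

Theorem theorem5 (R : realType) (n m : nat) (hm : (1 <= m)%N)
    (K : {set {set 'I_n}}) (hK : K \subset Simplices n m) :
  HMET R m K =
  (coord_proj R hK @` HMET R m (Simplices n m))%classic.
Proof.
apply/seteqP; split=> [d|_ [d hd <-]] /=; last first.
  move: hd; rewrite -(extend0K d) coord_proj_restr !HMET_restr.
  exact: hemimetricS.
move=> hd; have h0 := hd; rewrite -(extend0K d) HMET_restr in h0.
(* The value 0 outside [K] gives nonnegativity on all sets, as [extension] requires. *)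
have f0 D : 0 <= extend0 d D by rewrite /extend0; case: insub => // E; exact: hd.1.
exists (restr (Simplices n m) (extension m K (extend0 d))).
  by apply/HMET_restr; exact: hemimetric_extension.
rewrite coord_proj_restr -[RHS]extend0K; apply/ffunP => D.
by rewrite !ffunE extension_id // (valP D).
Qed.
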